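(* Let $A$ and $B$ be C$^*$-algebras, let $\mathcal{H}$ be a cyclic Hilbert $A$-module with unit cyclic vector $\xi\in\mathcal{H}$, and let $\mathcal{K}$ be a cyclic Hilbert $B$-module with unit cyclic vector $\eta\in\mathcal{K}$. Let $X$ be an operator $A,B$-bimodule and let $\phi$ be a completely contractive $A,B$-bimodule map from $\mathrm{B}(\mathcal{K},\mathcal{H})$ (or from $\mathrm{K}(\mathcal{K},\mathcal{H})$) into $X$. Then $\phi$ is completely isometric if and only if $\|\phi(\xi\otimes\eta^* )\|=1$.
   Context: A Hilbert $A$-module is a Hilbert space on which $A$ acts by a $*$-representation (regarded as an operator space with its column structure). A vector $\xi\in\mathcal{H}$ is cyclic if $A\xi$ is dense in $\mathcal{H}$; $\mathcal{H}$ is cyclic if it has a cyclic vector. $\mathrm{B}(\mathcal{K},\mathcal{H})$ and $\mathrm{K}(\mathcal{K},\mathcal{H})$ are the spaces of all bounded, respectively all compact, operators from $\mathcal{K}$ to $\mathcal{H}$; they are $A,B$-bimodules via $axb$, where $a$ and $b$ denote the operators by which $a\in A$ acts on $\mathcal{H}$ and $b\in B$ acts on $\mathcal{K}$. $\xi\otimes\eta^*$ is the rank one operator $\zeta\mapsto\langle\zeta,\eta\rangle\xi$. An operator $A,B$-bimodule is an operator space $X$ that is an $A,B$-bimodule and admits a completely isometric $A,B$-bimodule map into $\mathrm{B}(\mathcal{K}',\mathcal{H}')$ for some Hilbert $A$-module $\mathcal{H}'$ and Hilbert $B$-module $\mathcal{K}'$. *)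

(* Defs.v *)
From HB Require Import structures.
From mathcomp Require Import all_boot all_order all_algebra sesquilinear.
From mathcomp Require Import complex.
From mathcomp Require Import all_classical all_reals.
From mathcomp Require Import topology normedtype.

Set Implicit Arguments.
Unset Strict Implicit.
Unset Printing Implicit Defensive.

Import Order.TTheory GRing.Theory Num.Theory.
Import numFieldNormedType.Exports.

Local Open Scope classical_set_scope.
Local Open Scope ring_scope.
Local Open Scope complex_scope.

(* The field of complex numbers is R[i]; a normed module over it has a norm
   with values in R[i] (real and nonnegative), hence the real parts below. *)

(* C*-algebras are not assumed to be unital. *)
HB.mixin Record isCStarAlgebra (R : realType) A
    of CompleteNormedModule R[i] A := {
  cmul : A -> A -> A;
  cstar : A -> A;
  cmulA : forall a b c, cmul a (cmul b c) = cmul (cmul a b) c;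
  cmul_linearl : forall b, linear (cmul ^~ b);
  cmul_linearr : forall a, linear (cmul a);
  cstarK : forall a, cstar (cstar a) = a;
  cstar_antilinear : forall (k : R[i]) a b,
    cstar (k *: a + b) = Num.conj k *: cstar a + cstar b;
  cstarM : forall a b, cstar (cmul a b) = cmul (cstar b) (cstar a);
  cnormM_le : forall a b, `|cmul a b| <= `|a| * `|b|;
  cnorm_cstar : forall a, `|cmul (cstar a) a| = `|a| ^+ 2
}.

#[short(type="cstarAlgType")]
HB.structure Definition CStarAlgebra (R : realType) :=
  {A of isCStarAlgebra R A & CompleteNormedModule R[i] A}.

(* The inner product is linear in its first argument. *)
HB.mixin Record isHilbert (R : realType) H
    of CompleteNormedModule R[i] H := {
  dotp : {dot H for (@Num.conj R[i])};
  dotpp : forall x : H, dotp x x = `|x| ^+ 2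
}.

#[short(type="hilbertType")]
HB.structure Definition Hilbert (R : realType) :=
  {H of isHilbert R H & CompleteNormedModule R[i] H}.

Section BoundedOperators.
Variables (R : realType) (K H : hilbertType R).

Definition bounded_operator (f : K -> H) : Prop :=
  linear f /\ exists M : R[i], forall x, `|f x| <= M * `|x|.

Definition bounded_operator_pred : {pred K -> H} :=
  [pred f | `[< bounded_operator f >]].

Lemma bounded_operator_submod : submod_closed bounded_operator_pred.
Proof.
split=> [|k f g /asboolP[lf [M fM]] /asboolP[lg [N gN]]]; apply/asboolP.
  split; first by move=> k x y /=; rewrite /GRing.zero /= scaler0 addr0.
  by exists 0 => x; rewrite mul0r normr0.
split=> [a x y|].
  rewrite !fctE lf lg !scalerDr !scalerA (mulrC k a).
  by rewrite addrACA.
exists (`|k| * M + N) => x; rewrite !fctE.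
apply: (le_trans (ler_normD _ _)); rewrite mulrDl lerD//.
by rewrite normrZ -mulrA ler_wpM2l.
Qed.

HB.instance Definition _ :=
  GRing.isSubmodClosed.Build R[i] (K -> H) bounded_operator_pred
    bounded_operator_submod.

(* B(K, H) *)
Record bop := Bop {
  bop_fun :> K -> H;
  bopP : bop_fun \in bounded_operator_pred
}.

HB.instance Definition _ := [isSub for bop_fun].
HB.instance Definition _ := [Choice of bop by <:].
HB.instance Definition _ := [SubChoice_isSubLmodule of bop by <:].

Lemma bop_linear (f : bop) : linear f.
Proof. by have /asboolP[] := bopP f. Qed.

HB.instance Definition _ (f : bop) :=
  GRing.isLinear.Build R[i] K H *:%R (bop_fun f) (bop_linear f).

Lemma bop_bounded (f : bop) :
  exists2 M : R[i], 0 <= M & forall x, `|f x| <= M * `|x|.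
Proof.
have /asboolP[_ [M fM]] := bopP f; exists `|M| => // x.
have [->|x0] := eqVneq x 0; first by rewrite linear0 !normr0 mulr0.
suff M0 : 0 <= M by rewrite ger0_norm.
by rewrite -(@pmulr_lge0 _ `|x|) ?normr_gt0// (le_trans _ (fM x)).
Qed.

Lemma bop_continuous (f : bop) : continuous f.
Proof.
have [M M0 fM] := bop_bounded f; apply: (@bounded_linear_continuous _ _ _ f).
apply/bounded_funP => r; exists (M * r) => x xr.
by rewrite (le_trans (fM x))// ler_wpM2l.
Qed.

(* Compact operators map the closed unit ball to a relatively compact set. *)
Definition compact_operator (f : bop) : Prop :=
  precompact (f @` [set x | `|x| <= 1]).

Definition compact_operator_pred : {pred bop} :=
  [pred f | `[< compact_operator f >]].

Lemma precompact_image (X Y : topologicalType) (f : X -> Y) (A : set X) :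
  hausdorff_space Y -> continuous f -> precompact A -> precompact (f @` A).
Proof.
move=> hY cf; rewrite precompactE => cA.
have cfA : compact (f @` closure A).
  by apply: continuous_compact => //; exact: continuous_subspaceT.
apply: (@precompact_subset _ _ (f @` closure A)).
  exact: image_subset (@subset_closure _ A).
by rewrite (precompact_closed (compact_closed hY cfA)).
Qed.

Lemma compact_operator_submod : submod_closed compact_operator_pred.
Proof.
split=> [|k f g /asboolP cf /asboolP cg]; apply/asboolP.
  apply: (@precompact_subset _ _ [set 0]); first by move=> _ [x _ <-].
  rewrite precompactE.
  have /closure_id <- : closed [set (0 : H)].
    exact: (accessible_closed_set1 (hausdorff_accessible (@norm_hausdorff _ H))).
  exact: compact_set1.
have := cf; rewrite /compact_operator precompactE => cf'.
have := cg; rewrite /compact_operator precompactE => cg'.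
have cfg := compact_setX cf' cg'.
pose h (p : H * H) := k *: p.1 + p.2.
have ch : continuous h.
  move=> p; apply: cvgD; last exact: cvg_snd.
  by apply: cvgZr; exact: cvg_fst.
have {cfg} chfg := continuous_compact (continuous_subspaceT ch) cfg.
have {}chfg : precompact (h @` (closure (f @` [set x | `|x| <= 1]) `*`
                              closure (g @` [set x | `|x| <= 1]))).
  by rewrite precompact_closed//; exact: compact_closed (@norm_hausdorff _ H) _.
apply: precompact_subset chfg.
move=> _ [x x1 <-]; exists (f x, g x) => //.
by split; apply: subset_closure; exists x.
Qed.

HB.instance Definition _ :=
  GRing.isSubmodClosed.Build R[i] bop compact_operator_pred
    compact_operator_submod.

(* K(K, H) *)
Record kop := Kop {
  kop_bop :> bop;
  kopP : kop_bop \in compact_operator_pred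
}.

HB.instance Definition _ := [isSub for kop_bop].
HB.instance Definition _ := [Choice of kop by <:].
HB.instance Definition _ := [SubChoice_isSubLmodule of kop by <:].

End BoundedOperators.

Section Composition.
Variable R : realType.

Lemma bop_comp_subproof (H1 H2 H3 : hilbertType R)
    (f : bop H2 H3) (g : bop H1 H2) :
  (f \o g : H1 -> H3) \in @bounded_operator_pred R H1 H3.
Proof.
apply/asboolP; split; first by move=> k x y; rewrite /= !linearP.
have [M M0 fM] := bop_bounded f; have [N N0 gN] := bop_bounded g.
exists (M * N) => x /=; apply: (le_trans (fM _)).
by rewrite -mulrA ler_wpM2l.
Qed.

Definition bop_comp (H1 H2 H3 : hilbertType R)
    (f : bop H2 H3) (g : bop H1 H2) : bop H1 H3 :=
  Bop (bop_comp_subproof f g).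

Lemma kop_compl_subproof (H1 H2 H3 : hilbertType R)
    (f : bop H2 H3) (g : kop H1 H2) :
  bop_comp f g \in @compact_operator_pred R H1 H3.
Proof.
have /asboolP cg := kopP g; apply/asboolP.
have := precompact_image (@norm_hausdorff _ H3) (@bop_continuous _ _ _ f) cg.
by apply: precompact_subset => _ [x x1 <-]; exists (g x) => //; exists x.
Qed.

Definition kop_compl (H1 H2 H3 : hilbertType R)
    (f : bop H2 H3) (g : kop H1 H2) : kop H1 H3 :=
  Kop (kop_compl_subproof f g).

Lemma kop_compr_subproof (H1 H2 H3 : hilbertType R)
    (f : kop H2 H3) (g : bop H1 H2) :
  bop_comp f g \in @compact_operator_pred R H1 H3.
Proof.
have /asboolP cf := kopP f; apply/asboolP.
have [N N0 gN] := bop_bounded g.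
have N1 : 0 < N + 1 by rewrite ltr_pwDr.
have cN : continuous (fun y : H3 => (N + 1) *: y).
  by move=> y; apply: cvgZr; exact: cvg_id.
have := precompact_image (@norm_hausdorff _ H3) cN cf.
apply: precompact_subset => _ [x x1 <-]; exists (f ((N + 1)^-1 *: g x)).
  exists ((N + 1)^-1 *: g x) => //=.
  rewrite normrZ gtr0_norm ?invr_gt0// ler_pdivrMl// mulr1.
  rewrite (le_trans (gN x))//.
  by rewrite (le_trans (ler_wpM2l N0 x1))// mulr1 lerDl.
by rewrite /= linearZ /= scalerA mulfV ?scale1r// gt_eqF.
Qed.

Definition kop_compr (H1 H2 H3 : hilbertType R)
    (f : kop H2 H3) (g : bop H1 H2) : kop H1 H3 :=
  Kop (kop_compr_subproof f g).

End Composition.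

Section RankOne.
Variables (R : realType) (K H : hilbertType R).
Implicit Types (xi : H) (eta : K).

Lemma dotpC (x y : K) : dotp x y = Num.conj (dotp y x).
Proof. by have := hermC (@dotp R K) x y; rewrite /= expr0 mul1r. Qed.

Lemma dotp_cauchy_schwarz (x y : K) : `|dotp x y| <= `|x| * `|y|.
Proof.
have [->|y0] := eqVneq y 0; first by rewrite linear0r !normr0 mulr0.
have ny0 : 0 < `|y| ^+ 2 by rewrite exprn_gt0// normr_gt0.
rewrite -(@ler_pXn2r _ 2)// ?nnegrE ?mulr_ge0// exprMn.
pose c := dotp x y / `|y| ^+ 2.
have : 0 <= dotp (x - c *: y) (x - c *: y) by rewrite dotpp exprn_ge0.
rewrite linearBl !linearBr /= !linearZl_LR /= !linearZr_LR /= !dotpp.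
rewrite (dotpC y x).
have -> : Num.conj c = Num.conj (dotp x y) / `|y| ^+ 2.
  by rewrite /c rmorphM fmorphV/= (@geC0_conj _ (`|y| ^+ 2)) ?ltW.
have -> : c * (Num.conj (dotp x y)) -
    c * (Num.conj (dotp x y) / `|y| ^+ 2 * `|y| ^+ 2) = 0.
  by rewrite divfK ?gt_eqF// subrr.
rewrite subr0 -mulrA (mulrC _^-1) mulrA -normCKC subr_ge0.
by rewrite ler_pdivrMr.
Qed.

Lemma rank1_bop_subproof xi eta :
  (fun zeta => dotp zeta eta *: xi) \in @bounded_operator_pred R K H.
Proof.
apply/asboolP; split.
  by move=> k x y; rewrite linearPl /= scalerDl scalerA.
exists (`|eta| * `|xi|) => x.
rewrite normrZ mulrAC ler_wpM2r// mulrC.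
exact: dotp_cauchy_schwarz.
Qed.

(* The rank one operator xi (x) eta^* *)
Definition rank1_bop xi eta : bop K H := Bop (rank1_bop_subproof xi eta).

Lemma real_scale_continuous (y : H) :
  continuous (fun a : R^o => (real_complex R a) *: y).
Proof.
move=> a; apply/cvgrPdist_lt => /= e e0.
have er : (complex.Re e)%:C = e by rewrite RRe_real// ger0_real// ltW.
have yr : (complex.Re `|y|)%:C = `|y| by rewrite RRe_real// normr_real.
have y0 : 0 <= complex.Re `|y| by rewrite -ler0c yr.
have e0' : 0 < complex.Re e by rewrite -ltcR er.
have d0 : 0 < complex.Re e / (complex.Re `|y| + 1) by rewrite divr_gt0// ltr_wpDl.
near=> b.
rewrite -scalerBl normrZ -rmorphB/= -yr -er normc_def/= expr0n/= addr0 sqrtr_sqr.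
rewrite -rmorphM/= ltcR.
have ab : `|a - b| < complex.Re e / (complex.Re `|y| + 1).
  by near: b; apply: (@cvgr_dist_lt _ R^o).
apply: (@le_lt_trans _ _ (`|a - b| * (complex.Re `|y| + 1))).
  by rewrite ler_wpM2l// lerDl.
by rewrite -ltr_pdivlMr// ltr_wpDl.
Unshelve. all: by end_near. Qed.

Lemma rank1_compact xi eta : rank1_bop xi eta \in @compact_operator_pred R K H.
Proof.
apply/asboolP.
pose M : R := complex.Re `|eta|.
pose h (p : R^o * R^o) : H := p.1%:C *: xi + p.2%:C *: ('i *: xi).
have ch : continuous h.
  move=> p; apply: cvgD.
    apply: (@cvg_comp _ _ _ fst (fun a : R^o => a%:C *: xi)).
      exact: cvg_fst.
    exact: real_scale_continuous.
  apply: (@cvg_comp _ _ _ snd (fun a : R^o => a%:C *: ('i *: xi))).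
    exact: cvg_snd.
  exact: real_scale_continuous.
have cM : compact (`[- M, M]%classic : set R^o) by exact: segment_compact.
have chM := continuous_compact (continuous_subspaceT ch) (compact_setX cM cM).
have pM : precompact (h @` ((`[- M, M]%classic : set R^o) `*`
                            (`[- M, M]%classic : set R^o))).
  by rewrite precompact_closed//; exact: compact_closed (@norm_hausdorff _ H) _.
apply: precompact_subset pM => _ [x /= x1 <-].
pose z := dotp x eta.
have zM : Num.sqrt (complex.Re z ^+ 2 + complex.Im z ^+ 2) <= M.
  rewrite -lecR -normc_def RRe_real ?normr_real//.
  rewrite (le_trans (dotp_cauchy_schwarz x eta))//.
  by rewrite -[leRHS]mul1r ler_wpM2r.
exists (complex.Re z, complex.Im z).
  split => /=; rewrite in_itv/= -ler_norml (le_trans _ zM)// -sqrtr_sqr;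
    rewrite ler_wsqrtr//.
    by rewrite lerDl sqr_ge0.
  by rewrite lerDr sqr_ge0.
by rewrite /h/= scalerA -scalerDl mulrC -complexE.
Qed.

Definition rank1_kop xi eta : kop K H := Kop (rank1_compact xi eta).

End RankOne.

(* The norm of the Hilbert direct sum of n copies of H. *)
Definition dsum_norm (R : realType) (H : hilbertType R) n (z : 'I_n -> H) : R :=
  Num.sqrt (\sum_(i < n) complex.Re `|z i| ^+ 2).

(* The norm of a matrix over B(K, H), as an operator from K^n to H^n. *)
Definition bop_mxnorm (R : realType) (K H : hilbertType R) n
    (x : 'M[bop K H]_n) : R :=
  sup [set dsum_norm (fun i => \sum_(j < n) x i j (z j)) |
        z in [set z : 'I_n -> K | dsum_norm z <= 1]].

(* An operator space is a vector space with norms on its matrix spaces that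
   come from an embedding into some B(K, H). Completeness is not required. *)
HB.mixin Record isOperatorSpace (R : realType) V of GRing.Lmodule R[i] V := {
  mxnorm : forall n, 'M[V]_n -> R;
  mxnormP : exists (K H : hilbertType R) (J : {linear V -> bop K H}),
    forall n (x : 'M[V]_n), mxnorm n x = bop_mxnorm (map_mx J x)
}.

#[short(type="operatorSpaceType")]
HB.structure Definition OperatorSpace (R : realType) :=
  {V of isOperatorSpace R V & GRing.Lmodule R[i] V}.

Arguments mxnorm {R s n} _.

Section OperatorSpaceInstances.
Variables (R : realType) (K H : hilbertType R).

Lemma bop_mxnormP : exists (K' H' : hilbertType R)
    (J : {linear bop K H -> bop K' H'}),
  forall n (x : 'M[bop K H]_n), bop_mxnorm x = bop_mxnorm (map_mx J x).
Proof. by exists K, H, idfun => n x; rewrite map_mx_id. Qed.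

HB.instance Definition _ :=
  isOperatorSpace.Build R (bop K H) bop_mxnormP.

Definition kop_mxnorm n (x : 'M[kop K H]_n) : R :=
  bop_mxnorm (map_mx (@kop_bop R K H) x).

Lemma kop_mxnormP : exists (K' H' : hilbertType R)
    (J : {linear kop K H -> bop K' H'}),
  forall n (x : 'M[kop K H]_n), kop_mxnorm x = bop_mxnorm (map_mx J x).
Proof. by exists K, H, (\val : {linear kop K H -> bop K H}). Qed.

HB.instance Definition _ :=
  isOperatorSpace.Build R (kop K H) kop_mxnormP.

End OperatorSpaceInstances.

Definition opspace_norm (R : realType) (V : operatorSpaceType R) (v : V) : R :=
  mxnorm (const_mx v : 'M_1).

Definition completely_contractive (R : realType) (V W : operatorSpaceType R)
    (f : V -> W) : Prop :=
  forall n (x : 'M[V]_n), mxnorm (map_mx f x) <= mxnorm x.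

Definition completely_isometric (R : realType) (V W : operatorSpaceType R)
    (f : V -> W) : Prop :=
  forall n (x : 'M[V]_n), mxnorm (map_mx f x) = mxnorm x.

(* A Hilbert space with a *-representation of A, not assumed nondegenerate. *)
Record hilbertModule (R : realType) (A : cstarAlgType R) := HilbertModule {
  hm_space :> hilbertType R;
  hm_act : A -> bop hm_space hm_space;
  hm_act_linear : linear hm_act;
  hm_actM : forall a b, hm_act (cmul a b) = bop_comp (hm_act a) (hm_act b);
  hm_act_star : forall a x y,
    dotp (hm_act (cstar a) x) y = dotp x (hm_act a y)
}.

Definition cyclic_vector (R : realType) (A : cstarAlgType R)
    (H : hilbertModule A) (xi : H) : Prop :=
  dense (range (fun a : A => hm_act H a xi)).

Record bimodule (R : realType) (A B : cstarAlgType R) (V : lmodType R[i]) :=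
    Bimodule {
  lact : A -> V -> V;
  ract : V -> B -> V;
  lact_linearl : forall v, linear (lact ^~ v);
  lact_linearr : forall a, linear (lact a);
  ract_linearl : forall b, linear (ract ^~ b);
  ract_linearr : forall v, linear (ract v);
  lactA : forall a a' v, lact a (lact a' v) = lact (cmul a a') v;
  ractA : forall v b b', ract (ract v b) b' = ract v (cmul b b');
  lractA : forall a v b, ract (lact a v) b = lact a (ract v b)
}.

Definition bimodule_map (R : realType) (A B : cstarAlgType R)
    (V W : lmodType R[i]) (mV : bimodule A B V) (mW : bimodule A B W)
    (f : V -> W) : Prop :=
  (forall a v, f (lact mV a v) = lact mW a (f v)) /\
  (forall v b, f (ract mV v b) = ract mW (f v) b).

Section OperatorBimodules.
Variables (R : realType) (A B : cstarAlgType R).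
Variables (H : hilbertModule A) (K : hilbertModule B).

Lemma bop_eq (K' H' : hilbertType R) (f g : bop K' H') : f =1 g -> f = g.
Proof. by move=> fg; apply/val_inj/funext. Qed.

Definition bop_bimodule : bimodule A B (bop K H).
Proof.
exists (fun a f => bop_comp (hm_act H a) f) (fun f b => bop_comp f (hm_act K b)).
- by move=> f k a a'; apply: bop_eq => x /=; rewrite hm_act_linear.
- by move=> a k f g; apply: bop_eq => x /=; rewrite linearP.
- by move=> b k f g; apply: bop_eq => x.
- by move=> f k b b'; apply: bop_eq => x /=; rewrite hm_act_linear /= linearP.
- by move=> a a' f; apply: bop_eq => x /=; rewrite hm_actM.
- by move=> f b b'; apply: bop_eq => x /=; rewrite hm_actM.
- by move=> a f b; apply: bop_eq => x.
Defined.

Definition kop_bimodule : bimodule A B (kop K H).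
Proof.
exists (fun a f => kop_compl (hm_act H a) f)
       (fun f b => kop_compr f (hm_act K b)).
- by move=> f k a a'; apply/val_inj/bop_eq => x /=; rewrite hm_act_linear.
- by move=> a k f g; apply/val_inj/bop_eq => x /=; rewrite linearP.
- by move=> b k f g; apply/val_inj/bop_eq => x.
- by move=> f k b b'; apply/val_inj/bop_eq => x /=;
    rewrite hm_act_linear /= linearP.
- by move=> a a' f; apply/val_inj/bop_eq => x /=; rewrite hm_actM.
- by move=> f b b'; apply/val_inj/bop_eq => x /=; rewrite hm_actM.
- by move=> a f b; apply/val_inj/bop_eq => x.
Defined.

End OperatorBimodules.

Record operatorBimodule (R : realType) (A B : cstarAlgType R) :=
    OperatorBimodule {
  ob_space :> operatorSpaceType R;
  ob_bimodule : bimodule A B ob_space;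
  ob_repr : exists (H : hilbertModule A) (K : hilbertModule B)
      (J : {linear ob_space -> bop K H}),
    bimodule_map ob_bimodule (bop_bimodule H K) J /\ completely_isometric J
}.

(* Main.v *)
(* Let T be the operator by which phi (xi (x) eta^* ) acts; choose u in the
   unit ball with |T u| almost 1, and put v = T u.  Contractivity of phi on the
   operators a xi (x) eta^* and xi (x) (b eta)^* gives |a v| <= |a xi| and, up
   to a small error, |b u| <= |b eta|.  The norm of B(K, H) is smooth at
   xi (x) eta^*: if <y eta, xi> = 0 then |l (xi (x) eta^* ) + y| <= l + O(1/l),
   so a contractive functional whose value at xi (x) eta^* is close to 1 is
   close to x |-> <x eta, xi>; in particular <phi(x) u, v> is close to
   <x eta, xi>.  Applied to the sum of the a_i^* x_ij b_j, this bounds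
   sum <x_ij b_j eta, a_i xi> by the norm of the matrix (phi(x_ij)) times the
   norms of (b_j eta) and (a_i xi), and by cyclicity such vectors are dense.
   Only rank one operators and the norm of B(K, H) matter, so K(K, H) can be
   replaced by any sub-bimodule of B(K, H) containing xi (x) eta^*. *)
Require Import Defs.
From HB Require Import structures.
From mathcomp Require Import all_boot all_order all_algebra.
From mathcomp Require Import all_classical all_reals.
From mathcomp Require Import topology normedtype.
From mathcomp Require Import complex sesquilinear ring lra.

Import Order.TTheory GRing.Theory Num.Theory.
Import numFieldNormedType.Exports.

Local Open Scope classical_set_scope.
Local Open Scope ring_scope.
Local Open Scope complex_scope.

Set Implicit Arguments.
Unset Strict Implicit.

(** * Real-valued norm and real inner product of a complex Hilbert space *)

Section RealInnerProduct.
Variables (R : realType) (H : hilbertType R).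
Implicit Types (x y z : H) (r : R) (k : R[i]).

(** Norms take values in [R[i]]; the real versions let all estimates run over the ordered field
    [R]. *)
Definition nrm x : R := complex.Re `|x|.
Definition rdot x y : R := complex.Re (dotp x y).

Lemma nrmE x : (nrm x)%:C = `|x|.
Proof. by rewrite /nrm RRe_real ?normr_real. Qed.

Lemma nrm_ge0 x : 0 <= nrm x.
Proof. by rewrite -ler0c nrmE. Qed.

Lemma nrm_le x r : (`|x| <= r%:C) = (nrm x <= r).
Proof. by rewrite -nrmE lecR. Qed.

Lemma nrmD x y : nrm (x + y) <= nrm x + nrm y.
Proof. by rewrite -lecR rmorphD /= !nrmE ler_normD. Qed.

Lemma nrmN x : nrm (- x) = nrm x.
Proof. by rewrite /nrm normrN. Qed.

Lemma nrmZ k x : nrm (k *: x) = complex.Re `|k| * nrm x.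
Proof.
apply/(@complexI R).
by rewrite rmorphM /= !nrmE normrZ.
Qed.

Lemma rdotxx x : rdot x x = nrm x ^+ 2.
Proof.
apply/(@complexI R); rewrite rmorphXn /= nrmE -dotpp /rdot RRe_real//.
by rewrite dotpp rpredX// normr_real.
Qed.

Lemma rdotC x y : rdot x y = rdot y x.
Proof. by rewrite /rdot dotpC; case: (dotp y x). Qed.

Lemma rdotDl x y z : rdot (x + y) z = rdot x z + rdot y z.
Proof. by rewrite /rdot linearDl raddfD. Qed.

Lemma rdotNl x y : rdot (- x) y = - rdot x y.
Proof. by rewrite /rdot linearNl raddfN. Qed.

Lemma rdotDr x y z : rdot x (y + z) = rdot x y + rdot x z.
Proof. by rewrite rdotC rdotDl !(rdotC x). Qed.

Lemma rdotNr x y : rdot x (- y) = - rdot x y.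
Proof. by rewrite rdotC rdotNl rdotC. Qed.

Lemma rdotZl r x y : rdot (r%:C *: x) y = r * rdot x y.
Proof.
rewrite /rdot linearZl_LR /=; case: (dotp x y) => a b /=.
by rewrite mul0r subr0.
Qed.

Lemma rdotZr r x y : rdot x (r%:C *: y) = r * rdot x y.
Proof. by rewrite rdotC rdotZl rdotC. Qed.

Lemma rdot0l x : rdot 0 x = 0.
Proof. by rewrite /rdot linear0l. Qed.

Lemma rdot_suml I (s : seq I) (F : I -> H) y :
  rdot (\sum_(i <- s) F i) y = \sum_(i <- s) rdot (F i) y.
Proof.
elim: s => [|i s IH]; first by rewrite !big_nil rdot0l.
by rewrite !big_cons rdotDl IH.
Qed.

Lemma nrmD_sqr x y : nrm (x + y) ^+ 2 = nrm x ^+ 2 + 2 * rdot x y + nrm y ^+ 2.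
Proof. by rewrite -!rdotxx rdotDl !rdotDr (rdotC y x); ring. Qed.

Lemma Re_norm_dotp x y : complex.Re `|dotp x y| <= nrm x * nrm y.
Proof. by rewrite -lecR rmorphM /= !nrmE dotp_cauchy_schwarz. Qed.

Lemma rdot_le x y : rdot x y <= nrm x * nrm y.
Proof.
apply: le_trans (Re_norm_dotp x y); rewrite /rdot; case: (dotp x y) => a b.
rewrite normc_def /= (le_trans (ler_norm a))// -sqrtr_sqr ler_wsqrtr//.
by rewrite lerDl sqr_ge0.
Qed.

Lemma nrmZr r x : nrm (r%:C *: x) = `|r| * nrm x.
Proof. by rewrite nrmZ normc_def /= expr0n /= addr0 sqrtr_sqr. Qed.

(** Expand |x - r y|^2 >= 0 and divide by r. This weighted form of Cauchy-Schwarz can be summed over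
    coordinates without square roots. *)
Lemma rdot_sqr_le r x y : 0 < r ->
  2 * rdot x y <= r^-1 * nrm x ^+ 2 + r * nrm y ^+ 2.
Proof.
move=> r0; have := sqr_ge0 (nrm (x - r%:C *: y)).
rewrite nrmD_sqr nrmN rdotNr rdotZr nrmZr gtr0_norm// => h.
rewrite -(ler_pM2l r0).
have -> : r * (r^-1 * nrm x ^+ 2 + r * nrm y ^+ 2)
    = nrm x ^+ 2 + (r * nrm y) ^+ 2 by field; rewrite gt_eqF.
by lra.
Qed.

End RealInnerProduct.

(** * Matrices of operators acting on columns of vectors *)

Section RowAction.
Variables (R : realType) (K H : hilbertType R).

Lemma nrm_dotpZ (u w : K) (x : H) :
  nrm (dotp u w *: x) <= nrm u * nrm w * nrm x.
Proof. by rewrite nrmZ ler_wpM2r ?nrm_ge0// Re_norm_dotp. Qed.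

Lemma bop_nrm_bound (f : bop K H) :
  exists2 M : R, 0 <= M & forall z, nrm (f z) <= M * nrm z.
Proof.
have [M M0 fM] := bop_bounded f; exists (complex.Re M).
  by rewrite -ler0c RRe_real// ger0_real.
by move=> z; rewrite -lecR rmorphM /= !nrmE RRe_real ?ger0_real.
Qed.

Lemma bop_sumE I (s : seq I) (F : I -> bop K H) z :
  (\sum_(i <- s) F i) z = \sum_(i <- s) F i z.
Proof.
elim: s => [|i s IH]; first by rewrite !big_nil.
by rewrite !big_cons -IH.
Qed.

Definition sqnorm n (z : 'I_n -> H) : R := \sum_i nrm (z i) ^+ 2.

Lemma sqnorm_ge0 n (z : 'I_n -> H) : 0 <= sqnorm z.
Proof. by rewrite sumr_ge0// => i _; rewrite sqr_ge0. Qed.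

Lemma dsum_norm_sqr n (z : 'I_n -> H) : dsum_norm z ^+ 2 = sqnorm z.
Proof. by rewrite sqr_sqrtr// sqnorm_ge0. Qed.

Lemma nrm_dsum_norm n (z : 'I_n -> H) i : nrm (z i) <= dsum_norm z.
Proof.
rewrite -(@ler_pXn2r _ 2) ?nnegrE ?nrm_ge0 ?sqrtr_ge0// dsum_norm_sqr.
by rewrite /sqnorm (bigD1 i)//= lerDl sumr_ge0// => j _; rewrite sqr_ge0.
Qed.

(** Unfolds to the function whose norms [bop_mxnorm] takes the supremum of. *)
Definition mxact n (x : 'M[bop K H]_n) (z : 'I_n -> K) i : H :=
  \sum_j x i j (z j).

End RowAction.

(** * The matrix norm as the least bound on columns *)

Section MatrixNorm.
Variables (R : realType) (K H : hilbertType R).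

(** [sup] has a meaning only for a nonempty set that is bounded above, so all use of [bop_mxnorm]
    rests on this. *)
Lemma bop_mxnorm_has_sup n (x : 'M[bop K H]_n) :
  has_sup [set dsum_norm (mxact x z) | z in [set z | dsum_norm z <= 1]].
Proof.
split.
  exists (dsum_norm (mxact x (fun=> 0))); exists (fun=> 0) => //=.
  rewrite /dsum_norm big1 ?sqrtr0// => i _.
  by rewrite normr0 expr0n.
have /choice[M hM] (ij : 'I_n * 'I_n) : exists M : R,
    0 <= M /\ forall z, nrm (x ij.1 ij.2 z) <= M * nrm z.
  by have [M M0 h] := bop_nrm_bound (x ij.1 ij.2); exists M.
(* Each |z j| is at most 1, so coordinate i of the image is bounded by the i-th row sum of the entry
   bounds M. *)
exists (Num.sqrt (\sum_i (\sum_j M (i, j)) ^+ 2)) => _ [z /= z1 <-].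
rewrite ler_wsqrtr// ler_sum// => i _.
rewrite ler_pXn2r ?nnegrE ?nrm_ge0 ?sumr_ge0//; last first.
  by move=> j _; have [] := hM (i, j).
have nrm_sum (F : 'I_n -> H) : nrm (\sum_j F j) <= \sum_j nrm (F j).
  elim/big_ind2: _ => // [|u1 u2 v1 v2 h1 h2]; first by rewrite /nrm normr0.
  by rewrite (le_trans (nrmD _ _))// lerD.
apply: (le_trans (nrm_sum _)); apply: ler_sum => j _.
have [M0 h] := hM (i, j); apply: (le_trans (h _)).
by rewrite -[leRHS]mulr1 ler_wpM2l// (le_trans (nrm_dsum_norm z j)).
Qed.

Lemma bop_mxnorm_ge0 n (x : 'M[bop K H]_n) : 0 <= bop_mxnorm x.
Proof.
have [[r hr] ub] := bop_mxnorm_has_sup x.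
apply: (le_trans _ (ub_le_sup ub hr)).
by case: hr => z _ <-; exact: sqrtr_ge0.
Qed.

Lemma sqnorm_mxact n (x : 'M[bop K H]_n) z :
  sqnorm (mxact x z) <= bop_mxnorm x ^+ 2 * sqnorm z.
Proof.
have [_ ub] := bop_mxnorm_has_sup x.
set c := dsum_norm z.
have c0 : 0 <= c by exact: sqrtr_ge0.
(* If c = 0, every z j vanishes and so does the left side; otherwise rescale z by the inverse of c
   into the unit ball. *)
move: c0; rewrite le_eqVlt => /predU1P[c0|c0].
  have N0 := mulr_ge0 (sqr_ge0 (bop_mxnorm x)) (sqnorm_ge0 z).
  rewrite {1}/sqnorm big1// => i _.
  rewrite /mxact big1 => [|j _]; first by rewrite /nrm normr0 expr0n.
  have : nrm (z j) <= 0 by rewrite c0 nrm_dsum_norm.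
  rewrite -lecR nrmE rmorph0 normr_le0 => /eqP ->.
  by rewrite linear0.
have scal (G : hilbertType R) (w : 'I_n -> G) :
    sqnorm (fun j => c^-1%:C *: w j) = c^-1 ^+ 2 * sqnorm w.
  rewrite /sqnorm mulr_sumr; apply: eq_bigr => j _.
  by rewrite nrmZr exprMn real_normK ?num_real.
pose w j := c^-1%:C *: z j.
have w1 : dsum_norm w <= 1.
  rewrite -(@ler_pXn2r _ 2) ?nnegrE ?sqrtr_ge0// dsum_norm_sqr scal.
  by rewrite -dsum_norm_sqr exprVn mulVf ?expr1n// expf_neq0// gt_eqF.
have hw : dsum_norm (mxact x w) <= bop_mxnorm x.
  by apply: ub_le_sup => //; exists w.
have : sqnorm (mxact x w) <= bop_mxnorm x ^+ 2.
  have N0 := bop_mxnorm_ge0 x.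
  by rewrite -dsum_norm_sqr ler_pXn2r ?nnegrE ?sqrtr_ge0.
have -> : mxact x w = fun i => c^-1%:C *: mxact x z i.
  apply/funext => i; rewrite /mxact scaler_sumr; apply: eq_bigr => j _.
  by rewrite linearZ.
by rewrite scal exprVn ler_pdivrMl ?exprn_gt0// /c dsum_norm_sqr mulrC.
Qed.

Lemma bop_mxnorm_le n (x : 'M[bop K H]_n) (C : R) : 0 <= C ->
  (forall z, sqnorm (mxact x z) <= C ^+ 2 * sqnorm z) -> bop_mxnorm x <= C.
Proof.
move=> C0 h; have [ne _] := bop_mxnorm_has_sup x.
apply: ge_sup => // _ [z /= z1 <-].
rewrite -(@ler_pXn2r _ 2) ?nnegrE ?sqrtr_ge0// dsum_norm_sqr.
apply: (le_trans (h z)); rewrite -[leRHS]mulr1 ler_wpM2l ?sqr_ge0//.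
by rewrite -dsum_norm_sqr -[leRHS](expr1n _ 2) ler_pXn2r ?nnegrE ?sqrtr_ge0.
Qed.

Lemma bop_norm_le (f : bop K H) (C : R) : 0 <= C ->
  (forall z, nrm (f z) <= C * nrm z) -> bop_mxnorm (const_mx f : 'M_1) <= C.
Proof.
move=> C0 h; apply: bop_mxnorm_le => // z.
rewrite /sqnorm /mxact !big_ord1 mxE -exprMn.
by rewrite ler_pXn2r ?nnegrE ?mulr_ge0 ?nrm_ge0.
Qed.

Lemma nrm_bop (f : bop K H) z :
  nrm (f z) <= bop_mxnorm (const_mx f : 'M_1) * nrm z.
Proof.
have := sqnorm_mxact (const_mx f : 'M_1) (fun=> z).
rewrite /sqnorm /mxact !big_ord1 mxE -exprMn.
by rewrite ler_pXn2r ?nnegrE ?mulr_ge0 ?nrm_ge0 ?bop_mxnorm_ge0.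
Qed.

Lemma bop_norm_approx (f : bop K H) (C : R) :
  C < bop_mxnorm (const_mx f : 'M_1) ->
  exists2 z, nrm z <= 1 & C < nrm (f z).
Proof.
have [ne _] := bop_mxnorm_has_sup (const_mx f : 'M_1).
move=> /(sup_gt ne)[_ [z /= z1 <-]] h; exists (z ord0).
  exact: le_trans (nrm_dsum_norm z ord0) z1.
move: h; rewrite /dsum_norm /mxact !big_ord1 mxE sqrtr_sqr.
by rewrite ger0_norm ?nrm_ge0.
Qed.

End MatrixNorm.

(** * Smoothness of the operator norm at a rank one operator *)

Section RankOnePerturbation.
Variables (R : realType) (K H : hilbertType R) (xi : H) (eta : K).
Hypotheses (xi1 : nrm xi = 1) (eta1 : nrm eta = 1).

(** Split z = w + <z, eta> eta with w orthogonal to eta. Since y eta is orthogonal to xi, the cross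
    term sees only y w, hence is at most a M |w| with a = |<z, eta>|. *)
Lemma rank1_perturbation (y : bop K H) (M l : R) (z : K) :
  dotp (y eta) xi = 0 -> 0 <= M -> (forall w, nrm (y w) <= M * nrm w) ->
  0 < l ->
  nrm (l%:C *: rank1_bop xi eta z + y z) <= (l + l^-1 * M ^+ 2) * nrm z.
Proof.
move=> yxi M0 yM l0.
have etaeta : dotp eta eta = 1 by rewrite dotpp -nrmE eta1 expr1n.
pose w := z - dotp z eta *: eta; pose a := nrm (dotp z eta *: eta).
have a0 : 0 <= a by exact: nrm_ge0.
have ortho : rdot w (dotp z eta *: eta) = 0.
  rewrite rdotC /rdot linearZl_LR /= linearBr /= linearZr_LR /= etaeta.
  by rewrite mulr1 -dotpC subrr mulr0.
have zE : w + dotp z eta *: eta = z by rewrite subrK.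
have pyth : nrm z ^+ 2 = nrm w ^+ 2 + a ^+ 2.
  by rewrite -{1}zE nrmD_sqr ortho mulr0 addr0.
have np : nrm (rank1_bop xi eta z) = a by rewrite /a !nrmZ xi1 eta1.
have cross : rdot (rank1_bop xi eta z) (y z) <= a * (M * nrm w).
  have -> : rdot (rank1_bop xi eta z) (y z) = rdot (rank1_bop xi eta z) (y w).
    rewrite -{2}zE linearD rdotDr linearZ [X in _ + X](_ : _ = 0) ?addr0//.
    rewrite /rdot /= linearZl_LR /= linearZr_LR /=.
    by rewrite (dotpC xi) yxi !(conjC0, mulr0).
  rewrite (le_trans (rdot_le _ _))// np ler_wpM2l//.
have C0 : 0 <= l + l^-1 * M ^+ 2.
  by rewrite addr_ge0 ?mulr_ge0 ?invr_ge0 ?sqr_ge0// ltW.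
rewrite -(@ler_pXn2r _ 2) ?nnegrE ?(mulr_ge0 C0) ?nrm_ge0//.
rewrite nrmD_sqr nrmZr rdotZl np (gtr0_norm l0).
have yz2 : nrm (y z) ^+ 2 <= M ^+ 2 * nrm z ^+ 2.
  by rewrite -exprMn ler_pXn2r ?nnegrE ?mulr_ge0 ?nrm_ge0.
have -> : ((l + l^-1 * M ^+ 2) * nrm z) ^+ 2 =
    (l ^+ 2 + 2 * M ^+ 2 + (l^-1 * M ^+ 2) ^+ 2) * nrm z ^+ 2.
  by field; rewrite gt_eqF.
have h1 : l * rdot (rank1_bop xi eta z) (y z) <= l * (a * (M * nrm w)).
  by rewrite ler_pM2l.
(* This gives 2 l M a |w| <= l^2 |w|^2 + M^2 a^2. With [pyth], the squared norm is then at most (l^2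
   + 2 M^2) |z|^2, below the square of the claimed bound. *)
have h2 := sqr_ge0 (l * nrm w - M * a).
have h3 : 0 <= (l^-1 * M ^+ 2) ^+ 2 * nrm z ^+ 2 by rewrite mulr_ge0 ?sqr_ge0.
have h4 : 0 <= M ^+ 2 * nrm w ^+ 2 by rewrite mulr_ge0 ?sqr_ge0.
move: yz2 h3; rewrite pyth; nra.
Qed.

End RankOnePerturbation.

(** * Removing error terms, and sums over matrix entries *)

Lemma le_of_le_addM (R : realType) (p q C : R) : 0 <= C ->
  (forall s, 0 < s <= 1 -> p <= q + C * s) -> p <= q.
Proof.
move=> C0 h; rewrite leNgt; apply/negP => qp.
have D0 : 0 < p - q + C + 1 by lra.
(* For this value of s, C s is smaller than p - q. *)
have d1 : 0 < (p - q) / (p - q + C + 1) <= 1.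
  by rewrite divr_gt0 ?subr_gt0//= ler_pdivrMr//; lra.
have := h _ d1; rewrite mulrA -lerBlDl ler_pdivlMr//; nra.
Qed.

Section MatrixInequalities.
Variables (R : realType) (n : nat).

(** If p is the image of a column z under a matrix bounded by N, the weights turn the right side
    into at most N (|z|^2 + |q|^2). *)
Lemma sum_rdot_le (H : hilbertType R) (N : R) (p q : 'I_n -> H) : 0 < N ->
  2 * (\sum_i rdot (p i) (q i)) <= N^-1 * sqnorm p + N * sqnorm q.
Proof.
move=> N0; rewrite /sqnorm !mulr_sumr -big_split /=; apply: ler_sum => i _.
exact: rdot_sqr_le.
Qed.

(** Encodes a matrix pairing at orbit vectors as one coefficient of a single element of [V]: b_j
    acts on u, and the adjoint moves a_i over to w. *)
Lemma rdot_bimodule_sum (A B : cstarAlgType R) (H : hilbertModule A)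
    (K : hilbertModule B) (V : lmodType R[i]) (mV : bimodule A B V)
    (f : {linear V -> bop K H}) (x : 'M[V]_n) (a : 'I_n -> A) (b : 'I_n -> B)
    (u : K) (w : H) :
  bimodule_map mV (bop_bimodule H K) f ->
  rdot (f (\sum_i \sum_j lact mV (cstar (a i)) (ract mV (x i j) (b j))) u) w =
  \sum_i rdot (mxact (map_mx f x) (fun j => hm_act K (b j) u) i)
    (hm_act H (a i) w).
Proof.
move=> [fl fr]; rewrite linear_sum bop_sumE rdot_suml; apply: eq_bigr => i _.
rewrite linear_sum bop_sumE /mxact !rdot_suml; apply: eq_bigr => j _.
by rewrite fl fr mxE /= /rdot hm_act_star.
Qed.

End MatrixInequalities.

(** * Vectors at which the image of the rank one operator almost attains its norm *)

Section NormAttaining.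
Variables (R : realType) (A B : cstarAlgType R).
Variables (H H' : hilbertModule A) (K K' : hilbertModule B).
Variables (xi : H) (eta : K).
Hypotheses (xi1 : nrm xi = 1) (eta1 : nrm eta = 1).
Variables (V : lmodType R[i]) (mV : bimodule A B V).
Variables (iota : {linear V -> bop K H}) (psi : {linear V -> bop K' H'}).
Hypothesis iota_bimod : bimodule_map mV (bop_bimodule H K) iota.
Hypothesis psi_bimod : bimodule_map mV (bop_bimodule H' K') psi.
(** Contractivity is phrased through bounds, as [V] carries no norm of its own here. *)
Hypothesis psi_contr : forall x (C : R), 0 <= C ->
  (forall z, nrm (iota x z) <= C * nrm z) ->
  forall u, nrm (psi x u) <= C * nrm u.
Variable e : V.
Hypothesis iota_e : iota e = rank1_bop xi eta.

Lemma nrm_psi_e u : nrm (psi e u) <= nrm u.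
Proof.
rewrite -[leRHS]mul1r; apply: psi_contr => // z.
by rewrite iota_e (le_trans (nrm_dotpZ _ _ _))// xi1 eta1 !mulr1 mul1r.
Qed.

(** The element a e corresponds to the rank one operator of a xi and eta, which has norm |a xi|. *)
Lemma nrm_act_psi_e a u :
  nrm (hm_act H' a (psi e u)) <= nrm (hm_act H a xi) * nrm u.
Proof.
have -> : hm_act H' a (psi e u) = psi (lact mV a e) u.
  by rewrite psi_bimod.1.
apply: psi_contr => [|z]; first exact: nrm_ge0.
rewrite iota_bimod.1 iota_e /= linearZ.
by rewrite (le_trans (nrm_dotpZ _ _ _))// eta1 mulr1 mulrC.
Qed.

(** The element e b^* corresponds to z |-> <z, b eta> xi, which has norm |b eta|. *)
Lemma nrm_psi_e_act b u :
  nrm (psi e (hm_act K' (cstar b) u)) <= nrm (hm_act K b eta) * nrm u.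
Proof.
have -> : psi e (hm_act K' (cstar b) u) = psi (ract mV e (cstar b)) u.
  by rewrite psi_bimod.2.
apply: psi_contr => [|z]; first exact: nrm_ge0.
rewrite iota_bimod.2 iota_e /= hm_act_star.
by rewrite (le_trans (nrm_dotpZ _ _ _))// xi1 mulr1 mulrC.
Qed.

(** The slack is s^2 so that an error of order s is left after division by s. *)
Definition near_attains (s : R) (u : K') : Prop :=
  nrm u <= 1 /\ 1 - nrm (psi e u) ^+ 2 <= s ^+ 2.

(** A variational argument: u almost maximises |psi e u| on the unit ball, so moving it in the
    direction z = b^* b u cannot gain much, while <z, u> = |b u|^2. The constant depends on b
    alone. *)
Lemma nrm_act_near b : exists2 C : R, 0 <= C & forall s u, 0 < s ->
  near_attains s u ->
  nrm (hm_act K' b u) ^+ 2 <= nrm (hm_act K b eta) ^+ 2 + C * s.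
Proof.
have [M M0 hM] := bop_nrm_bound (bop_comp (hm_act K' (cstar b)) (hm_act K' b)).
exists (1 + M ^+ 2) => [|s u s0 [u1 hu]]; first by rewrite addr_ge0// sqr_ge0.
set z := hm_act K' (cstar b) (hm_act K' b u).
have z2 : nrm z ^+ 2 <= M ^+ 2.
  rewrite ler_pXn2r ?nnegrE ?nrm_ge0//; apply: (le_trans (hM u)).
  by rewrite -[leRHS]mulr1 ler_wpM2l.
have zu : rdot z u = nrm (hm_act K' b u) ^+ 2.
  by rewrite /rdot hm_act_star -rdotxx.
(* The first order term in s of this inequality gives the claim. *)
have : nrm (psi e (u - s%:C *: z)) ^+ 2 <= nrm (u - s%:C *: z) ^+ 2.
  by rewrite ler_pXn2r ?nnegrE ?nrm_ge0 ?nrm_psi_e.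
rewrite linearB linearZ /= !nrmD_sqr !nrmN !rdotNr !rdotZr !nrmZr.
rewrite (gtr0_norm s0).
rewrite (rdotC u) zu.
have u2 : nrm u ^+ 2 <= 1 by rewrite expr_le1 ?nrm_ge0.
have v1 : nrm (psi e u) <= 1 by rewrite (le_trans (nrm_psi_e u)).
(* Here z is b^* applied to b u, so [nrm_psi_e_act] applies at the vector b u. *)
have : rdot (psi e u) (psi e z) <=
    nrm (hm_act K b eta) * nrm (hm_act K' b u).
  rewrite (le_trans (rdot_le _ _))//.
  rewrite -[leRHS]mul1r ler_pM ?nrm_ge0//; exact: nrm_psi_e_act.
move: (sqr_ge0 (nrm (hm_act K b eta) - nrm (hm_act K' b u))) => h1 h2 h3.
have : s ^+ 2 * nrm z ^+ 2 <= s ^+ 2 * M ^+ 2 by rewrite ler_wpM2l ?sqr_ge0.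
move: (sqr_ge0 (s * nrm (psi e z))) => h4 h5.
(* The product |b eta| |b u| is split into squares; half of the term 2 s |b u|^2 then survives. *)
have h6 : s * (2 * rdot (psi e u) (psi e z)) <=
    s * (nrm (hm_act K b eta) ^+ 2 + nrm (hm_act K' b u) ^+ 2).
  by rewrite ler_pM2l//; nra.
rewrite -(ler_pM2l s0); nra.
Qed.

(** Smoothness with l = s^-1: pairing psi (s^-1 e + c e - x) u with v = psi e u gives at most s^-1 +
    M^2 s, and s^-1 |v|^2 is within s of s^-1. The constant does not depend on u. *)
Lemma rdot_psi_near x : exists2 C : R, 0 <= C & forall s u, 0 < s <= 1 ->
  near_attains s u ->
  rdot (iota x eta) xi <= rdot (psi x u) (psi e u) + C * s.
Proof.
set c := dotp (iota x eta) xi.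
(* Subtracting from c e makes the coefficient at (eta, xi) vanish; the sign of x yields a lower
   bound for <psi x u, psi e u>. *)
have [M M0 hM] := bop_nrm_bound (iota (c *: e - x)).
have ee : dotp eta eta = 1 by rewrite dotpp -nrmE eta1 expr1n.
have xx : dotp xi xi = 1 by rewrite dotpp -nrmE xi1 expr1n.
exists (1 + M ^+ 2 + `|complex.Re c|) => [|s u /andP[s0 s1] [u1 hu]].
  by rewrite !addr_ge0// sqr_ge0.
have y0 : dotp (iota (c *: e - x) eta) xi = 0.
  have -> : iota (c *: e - x) eta = c *: (dotp eta eta *: xi) - iota x eta.
    by rewrite linearB linearZ iota_e.
  by rewrite ee scale1r linearBl /= linearZl_LR /= xx mulr1 subrr.
have v1 : nrm (psi e u) <= 1 by rewrite (le_trans (nrm_psi_e u)).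
have v2 : nrm (psi e u) ^+ 2 <= 1 by rewrite expr_le1 ?nrm_ge0.
have : rdot (psi (s^-1%:C *: e + (c *: e - x)) u) (psi e u) <=
    s^-1 + s * M ^+ 2.
  rewrite (le_trans (rdot_le _ _))//.
  have C0 : 0 <= s^-1 + s * M ^+ 2.
    by rewrite addr_ge0 ?invr_ge0 ?mulr_ge0 ?sqr_ge0// ltW.
  rewrite -[leRHS]mulr1 ler_pM ?nrm_ge0//.
  rewrite -[leRHS]mulr1 (le_trans (psi_contr C0 _ u)) ?ler_wpM2l// => z.
  rewrite linearD linearZ iota_e /=.
  have := rank1_perturbation xi1 eta1 z y0 M0 hM.
  by move=> /(_ s^-1); rewrite invrK invr_gt0 => /(_ s0).
rewrite !linearD !linearZ linearN /= !rdotDl rdotNl rdotZl rdotxx.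
have -> : rdot (c *: psi e u) (psi e u) = complex.Re c * nrm (psi e u) ^+ 2.
  rewrite /rdot linearZl_LR /= dotpp -nrmE -rmorphXn /=.
  by case: c {hM y0} => p q /=; rewrite mulr0 subr0.
rewrite {2}/rdot -/c => h.
have h1 : s^-1 * (1 - nrm (psi e u) ^+ 2) <= s.
  by rewrite ler_pdivrMl.
(* The defect 1 - |v|^2 is at most s^2, hence at most s since s <= 1. *)
have h2 : complex.Re c * (1 - nrm (psi e u) ^+ 2) <= `|complex.Re c| * s.
  apply: (@le_trans _ _ (`|complex.Re c| * (1 - nrm (psi e u) ^+ 2))).
    by rewrite ler_wpM2r ?subr_ge0// ler_norm.
  by rewrite ler_wpM2l// (le_trans hu)// expr2 -[leRHS]mulr1 ler_wpM2l// ltW.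
nra.
Qed.

Hypothesis attains : forall s, 0 < s -> exists u, near_attains s u.
Variables (n : nat) (x : 'M[V]_n) (N : R).
Hypothesis N0 : 0 < N.
Hypothesis psi_x : forall z,
  sqnorm (mxact (map_mx psi x) z) <= N ^+ 2 * sqnorm z.

(** The pairing for [iota] at b_j eta and a_i xi is replaced by that for [psi] at b_j u and a_i v
    with v = psi e u. There [psi_x] applies, and the new vectors are no longer than the old ones up
    to order s. *)
Lemma iota_le_on_orbits (a : 'I_n -> A) (b : 'I_n -> B) :
  2 * (\sum_i rdot (mxact (map_mx iota x) (fun j => hm_act K (b j) eta) i)
         (hm_act H (a i) xi)) <=
  N * (sqnorm (fun j => hm_act K (b j) eta) +
       sqnorm (fun i => hm_act H (a i) xi)).
Proof.
set z := fun j => hm_act K (b j) eta; set w := fun i => hm_act H (a i) xi.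
pose X0 :=
  \sum_i \sum_j lact mV (cstar (a i)) (ract mV (x i j) (b j)).
have [C C0 hC] := rdot_psi_near X0.
have /choice[D hD] (j : 'I_n) : exists D : R, 0 <= D /\ forall s u, 0 < s ->
    near_attains s u -> nrm (hm_act K' (b j) u) ^+ 2 <= nrm (z j) ^+ 2 + D * s.
  by have [D D0 h] := nrm_act_near (b j); exists D.
have SD0 : 0 <= \sum_j D j by apply: sumr_ge0 => j _; have [] := hD j.
(* 2 C pays for passing from [iota] to [psi], and N times the sum of the D j for passing from b_j u
   to b_j eta. *)
apply: (@le_of_le_addM _ _ _ (2 * C + N * \sum_j D j)).
  by rewrite addr_ge0 ?mulr_ge0// ltW.
move=> s /[dup] s01 /andP[s0 s1]; have [u /[dup] us [u1 _]] := attains s0.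
have := hC s u s01 us.
rewrite !(rdot_bimodule_sum _ _ _ _ _ iota_bimod).
rewrite !(rdot_bimodule_sum _ _ _ _ _ psi_bimod).
rewrite -/z -/w.
set z' := (X in mxact (map_mx psi x) X).
set w' := fun i => hm_act H' (a i) (psi e u).
have := sum_rdot_le (mxact (map_mx psi x) z') w' N0.
have z'_le : sqnorm z' <= sqnorm z + (\sum_j D j) * s.
  rewrite /sqnorm mulr_suml -big_split /=; apply: ler_sum => j _.
  by have [_] := hD j; apply.
have w'_le : sqnorm w' <= sqnorm w.
  apply: ler_sum => i _; rewrite ler_pXn2r ?nnegrE ?nrm_ge0//.
  rewrite (le_trans (nrm_act_psi_e _ _))// -[leRHS]mulr1.
  by rewrite ler_wpM2l ?nrm_ge0.
have psi_le : N^-1 * sqnorm (mxact (map_mx psi x) z') <= N * sqnorm z'.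
  by rewrite ler_pdivrMl// mulrA -expr2.
have h1 : N * sqnorm z' <= N * (sqnorm z + (\sum_j D j) * s).
  by rewrite ler_pM2l.
have h2 : N * sqnorm w' <= N * sqnorm w by rewrite ler_pM2l.
lra.
Qed.

End NormAttaining.

(** * From orbits of cyclic vectors to all vectors *)

Lemma cyclic_vector_approx (R : realType) (A : cstarAlgType R)
    (H : hilbertModule A) (xi : H) : cyclic_vector xi ->
  forall z (s : R), 0 < s -> exists a, nrm (z - hm_act H a xi) <= s.
Proof.
move=> dxi z s s0; have s0' : 0 < s%:C by rewrite ltcR.
have [||x [zx [a _ ax]]] := dxi (ball z s%:C).
- by exists z; exact: ballxx.
- exact: ball_open.
exists a; rewrite ax -nrm_le; apply: ltW.
by move: zx; rewrite -ball_normE.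
Qed.

Section DenseInequality.
Variables (R : realType) (K H : hilbertType R).

(** Change one argument at a time; s <= 1 gives |z'| <= |z| + 1, so the constant does not depend on
    z' and w'. *)
Lemma rdot_bop_perturbation (f : bop K H) z w : exists2 C : R, 0 <= C &
  forall s z' w', 0 < s <= 1 -> nrm (z - z') <= s -> nrm (w - w') <= s ->
    rdot (f z) w <= rdot (f z') w' + C * s.
Proof.
have [M M0 hM] := bop_nrm_bound f.
exists (M * nrm w + M * (nrm z + 1)) => [|s z' w' /andP[s0 s1] hz hw].
  by rewrite addr_ge0 ?mulr_ge0 ?addr_ge0 ?nrm_ge0.
have -> : rdot (f z) w = rdot (f z') w' + rdot (f (z - z')) w
    + rdot (f z') (w - w').
  by rewrite linearB rdotDl rdotNl rdotDr rdotNr; ring.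
have h1 : rdot (f (z - z')) w <= M * s * nrm w.
  apply: (le_trans (rdot_le _ _)); rewrite ler_wpM2r ?nrm_ge0//.
  by rewrite (le_trans (hM _))// ler_wpM2l.
have h2 : rdot (f z') (w - w') <= M * (nrm z + 1) * s.
  apply: (le_trans (rdot_le _ _)); rewrite ler_pM ?nrm_ge0//.
  rewrite (le_trans (hM _))// ler_wpM2l//.
  have -> : z' = z + - (z - z') by rewrite opprB addrC subrK.
  rewrite (le_trans (nrmD _ _))// nrmN; lra.
lra.
Qed.

Lemma nrm_sqr_perturbation (z z' : H) (s : R) : 0 < s <= 1 ->
  nrm (z - z') <= s -> nrm z' ^+ 2 <= nrm z ^+ 2 + (2 * nrm z + 1) * s.
Proof.
move=> /andP[s0 s1] hz; have := nrm_ge0 z; have := nrm_ge0 z'.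
have : nrm z' <= nrm z + s.
  have {1}-> : z' = z + - (z - z') by rewrite opprB addrC subrK.
  by rewrite (le_trans (nrmD _ _))// nrmN lerD2l.
nra.
Qed.

End DenseInequality.

(** [P] and [Q] describe dense sets of entries. Approximating all entries within s changes both
    sides by at most a constant times s. *)
Lemma form_le_dense (R : realType) (K H : hilbertType R) (n : nat)
    (X : 'M[bop K H]_n) (N : R) (P : K -> Prop) (Q : H -> Prop) :
  0 <= N ->
  (forall z (s : R), 0 < s -> exists z', P z' /\ nrm (z - z') <= s) ->
  (forall w (s : R), 0 < s -> exists w', Q w' /\ nrm (w - w') <= s) ->
  (forall z w, (forall j, P (z j)) -> (forall i, Q (w i)) ->
    2 * (\sum_i rdot (mxact X z i) (w i)) <= N * (sqnorm z + sqnorm w)) ->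
  forall z w,
    2 * (\sum_i rdot (mxact X z i) (w i)) <= N * (sqnorm z + sqnorm w).
Proof.
move=> N0 dP dQ hPQ z w.
have /choice[C hC] (ij : 'I_n * 'I_n) : exists C : R, 0 <= C /\
    forall s z' w', 0 < s <= 1 -> nrm (z ij.2 - z') <= s ->
    nrm (w ij.1 - w') <= s ->
    rdot (X ij.1 ij.2 (z ij.2)) (w ij.1) <= rdot (X ij.1 ij.2 z') w' + C * s.
  have [C C0 h] := rdot_bop_perturbation (X ij.1 ij.2) (z ij.2) (w ij.1).
  by exists C.
pose CX := \sum_i \sum_j C (i, j).
pose Cz := \sum_j (2 * nrm (z j) + 1); pose Cw := \sum_i (2 * nrm (w i) + 1).
have CX0 : 0 <= CX.
  by apply: sumr_ge0 => i _; apply: sumr_ge0 => j _; have [] := hC (i, j).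
have Cz0 : 0 <= Cz.
  by apply: sumr_ge0 => j _; rewrite addr_ge0 ?mulr_ge0 ?nrm_ge0.
have Cw0 : 0 <= Cw.
  by apply: sumr_ge0 => j _; rewrite addr_ge0 ?mulr_ge0 ?nrm_ge0.
apply: (@le_of_le_addM _ _ _ (2 * CX + N * (Cz + Cw))).
  by rewrite addr_ge0 ?mulr_ge0 ?addr_ge0.
move=> s /[dup] s01 /andP[s0 s1].
have /choice[z' hz] j := dP (z j) s s0.
have /choice[w' hw] i := dQ (w i) s s0.
have hX : \sum_i rdot (mxact X z i) (w i) <=
    \sum_i rdot (mxact X z' i) (w' i) + CX * s.
  rewrite mulr_suml -big_split /=; apply: ler_sum => i _.
  rewrite !rdot_suml mulr_suml -big_split /=; apply: ler_sum => j _.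
  have [_ h] := hC (i, j); apply: h => //; first exact: (hz j).2.
  exact: (hw i).2.
have hz2 : sqnorm z' <= sqnorm z + Cz * s.
  rewrite mulr_suml -big_split /=; apply: ler_sum => j _.
  by apply: nrm_sqr_perturbation => //; exact: (hz j).2.
have hw2 : sqnorm w' <= sqnorm w + Cw * s.
  rewrite mulr_suml -big_split /=; apply: ler_sum => i _.
  by apply: nrm_sqr_perturbation => //; exact: (hw i).2.
have := hPQ z' w' (fun j => (hz j).1) (fun i => (hw i).1).
have : N * (sqnorm z' + sqnorm w') <=
    N * (sqnorm z + Cz * s + (sqnorm w + Cw * s)) by rewrite ler_wpM2l// lerD.
lra.
Qed.

(** Take w = N^-1 X z: half of the left side then cancels against the term in w. *)
Lemma sqnorm_mxact_le (R : realType) (K H : hilbertType R) (n : nat)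
    (X : 'M[bop K H]_n) (N : R) : 0 < N ->
  (forall z w, 2 * (\sum_i rdot (mxact X z i) (w i)) <=
    N * (sqnorm z + sqnorm w)) ->
  forall z, sqnorm (mxact X z) <= N ^+ 2 * sqnorm z.
Proof.
move=> N0 h z; have := h z (fun i => N^-1%:C *: mxact X z i).
have -> : \sum_i rdot (mxact X z i) (N^-1%:C *: mxact X z i)
    = N^-1 * sqnorm (mxact X z).
  rewrite mulr_sumr; apply: eq_bigr => i _.
  by rewrite rdotZr rdotxx.
have -> : sqnorm (fun i => N^-1%:C *: mxact X z i)
    = N^-1 ^+ 2 * sqnorm (mxact X z).
  rewrite mulr_sumr; apply: eq_bigr => j _.
  by rewrite nrmZr exprMn real_normK ?num_real.
have -> : N * (sqnorm z + N^-1 ^+ 2 * sqnorm (mxact X z)) =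
    N * sqnorm z + N^-1 * sqnorm (mxact X z) by field; rewrite gt_eqF.
have -> : 2 * (N^-1 * sqnorm (mxact X z)) =
  N^-1 * sqnorm (mxact X z) + N^-1 * sqnorm (mxact X z) by ring.
by rewrite lerD2r ler_pdivrMl// mulrA -expr2.
Qed.

Lemma rank1_bop_norm (R : realType) (K H : hilbertType R) (xi : H) (eta : K) :
  nrm xi = 1 -> nrm eta = 1 ->
  bop_mxnorm (const_mx (rank1_bop xi eta) : 'M_1) = 1.
Proof.
move=> xi1 eta1; apply/eqP; rewrite eq_le; apply/andP; split.
  apply: bop_norm_le => // z.
  by rewrite (le_trans (nrm_dotpZ _ _ _))// xi1 eta1 !mulr1 mul1r.
have := nrm_bop (rank1_bop xi eta) eta.
by rewrite /= dotpp -nrmE eta1 expr1n scale1r xi1 mulr1.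
Qed.

(** * The criterion for bimodules embedded in B(K, H) *)

Section BimoduleMaps.
Variables (R : realType) (A B : cstarAlgType R).
Variables (H : hilbertModule A) (K : hilbertModule B) (xi : H) (eta : K).
Hypotheses (cyclic_xi : cyclic_vector xi) (cyclic_eta : cyclic_vector eta).
Hypotheses (xi1 : nrm xi = 1) (eta1 : nrm eta = 1).
Variables (V : operatorSpaceType R) (mV : bimodule A B V).
Variable iota : {linear V -> bop K H}.
Hypothesis iota_bimod : bimodule_map mV (bop_bimodule H K) iota.
Hypothesis iota_isom : completely_isometric iota.
Variable e : V.
Hypothesis iota_e : iota e = rank1_bop xi eta.
Variables (X : operatorBimodule A B) (phi : {linear V -> X}).
Hypothesis phi_bimod : bimodule_map mV (ob_bimodule X) phi.
Hypothesis phi_contr : completely_contractive phi.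

Lemma completely_isometric_rank1 :
  completely_isometric phi <-> opspace_norm (phi e) = 1.
Proof.
have normV n (x : 'M[V]_n) : mxnorm x = bop_mxnorm (map_mx iota x).
  by rewrite -iota_isom.
split=> [isom|phi_e1].
  have := isom 1%N (const_mx e); rewrite map_const_mx /opspace_norm => ->.
  by rewrite normV map_const_mx iota_e rank1_bop_norm.
have [H' [K' [J [[Jl Jr] J_isom]]]] := ob_repr X.
pose psi : {linear V -> bop K' H'} := J \o phi.
have psi_bimod : bimodule_map mV (bop_bimodule H' K') psi.
  split=> [a v|v b]; first by rewrite /psi /= phi_bimod.1 Jl.
  by rewrite /psi /= phi_bimod.2 Jr.
have normphi n (x : 'M[V]_n) :
    mxnorm (map_mx phi x) = bop_mxnorm (map_mx psi x).
  by rewrite -J_isom -map_mx_comp.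
have psi_contr (x : V) (C : R) : 0 <= C ->
    (forall z, nrm (iota x z) <= C * nrm z) ->
    forall u, nrm (psi x u) <= C * nrm u.
  move=> C0 h u; apply: (le_trans (nrm_bop _ _)).
  rewrite ler_wpM2r ?nrm_ge0//.
  have := phi_contr (const_mx x : 'M_1).
  rewrite normphi normV !map_const_mx => /le_trans; apply.
  exact: bop_norm_le.
have attains s : 0 < s -> exists u, near_attains psi e s u.
  move=> s0; have psi_e1 : bop_mxnorm (const_mx (psi e) : 'M_1) = 1.
    by have := normphi 1%N (const_mx e); rewrite !map_const_mx => <-.
  (* If |v| > 1 - s^2 / 2, then 1 - |v|^2 <= 2 (1 - |v|) < s^2. *)
  have [|u u1 hu] := @bop_norm_approx _ _ _ (psi e) (1 - s ^+ 2 / 2).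
    by rewrite psi_e1 gtrBl divr_gt0 ?exprn_gt0.
  exists u; split=> //; have := sqr_ge0 (nrm (psi e u) - 1); nra.
move=> n x; apply/eqP; rewrite eq_le phi_contr /=.
(* The slack d makes the bound N positive even when [psi] annihilates the matrix. *)
apply/ler_addgt0Pr => d d0; rewrite normphi normV.
have M0 := bop_mxnorm_ge0 (map_mx psi x).
have N0 : 0 < bop_mxnorm (map_mx psi x) + d by rewrite ltr_wpDl.
apply: bop_mxnorm_le; first exact: ltW.
apply: sqnorm_mxact_le => //.
apply: (@form_le_dense _ _ _ _ _ _ (fun z => exists b, z = hm_act K b eta)
  (fun w => exists a, w = hm_act H a xi)); first exact: ltW.
- move=> z s s0; have [b hb] := cyclic_vector_approx cyclic_eta z s0.
  by exists (hm_act K b eta); split => //; exists b.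
- move=> w s s0; have [a ha] := cyclic_vector_approx cyclic_xi w s0.
  by exists (hm_act H a xi); split => //; exists a.
move=> z w /choice[b /funext ->] /choice[a /funext ->].
apply: (iota_le_on_orbits xi1 eta1 iota_bimod psi_bimod psi_contr iota_e
  attains N0) => z'.
apply: (le_trans (sqnorm_mxact _ _)); rewrite ler_wpM2r ?sqnorm_ge0//.
by rewrite ler_pXn2r ?nnegrE// ?lerDl ltW.
Qed.

End BimoduleMaps.

Unset Implicit Arguments.
Set Strict Implicit.

Theorem theorem3p1 (R : realType) (A B : cstarAlgType R)
    (H : hilbertModule A) (xi : H) (Hxi : cyclic_vector xi) (xi1 : `|xi| = 1)
    (K : hilbertModule B) (eta : K) (Keta : cyclic_vector eta)
    (eta1 : `|eta| = 1) (X : operatorBimodule A B) :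
  (forall phi : {linear bop K H -> X},
     bimodule_map (bop_bimodule H K) (ob_bimodule X) phi ->
     completely_contractive phi ->
     (completely_isometric phi <-> opspace_norm (phi (rank1_bop xi eta)) = 1))
  /\
  (forall phi : {linear kop K H -> X},
     bimodule_map (kop_bimodule H K) (ob_bimodule X) phi ->
     completely_contractive phi ->
     (completely_isometric phi <-> opspace_norm (phi (rank1_kop xi eta)) = 1)).
Proof.
have nxi : nrm xi = 1 by rewrite /nrm xi1.
have neta : nrm eta = 1 by rewrite /nrm eta1.
split=> phi phi_bimod phi_contr.
  apply: (@completely_isometric_rank1 _ _ _ _ _ _ _ Hxi Keta nxi neta _
    (bop_bimodule H K) idfun) => //.
  by move=> n x; rewrite map_mx_id.
(* For compact operators the embedding is the inclusion, through which their matrix norms are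
   defined. *)
exact: (@completely_isometric_rank1 _ _ _ _ _ _ _ Hxi Keta nxi neta _
  (kop_bimodule H K) (\val : {linear kop K H -> bop K H})).
Qed.
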